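(* Let $H\in\mathcal N_2$ be a normal affine semigroup in $\mathbb N^2$ with extremal rays $\mathbf a_1=(x_1,y_1)$ and $\mathbf a_2=(x_2,y_2)$, labeled so that $\mathbf a_1$ is closer to the $x$-axis, and let $\mathbf b=(u,v)$ be the bottom element of $H$. For any integer $i$ let $r_i$ be the integer with $r_i\equiv iy_1\bmod x_1$ and $0\le r_i<x_1$. Then $H$ is AG1 if and only if $r_k+r_\ell<2x_1-(vx_1-uy_1)$ for all integers $k,\ell\in\pi_1(H_1^* )$ with $k+\ell<x_1$.
   Context: $\mathbb N=\{0,1,2,\dots\}$. $\mathcal N_2$ is the class of normal affine semigroups $H\subseteq\mathbb N^2$ generating $\mathbb Z^2$ as a group: $H$ is a finitely generated submonoid of $\mathbb N^2$ with $H=C\cap\mathbb Z^2$, where $C\subseteq\mathbb R^2$ is the (two-dimensional) cone generated by $H$. The extremal rays of $H$ are the primitive lattice vectors $\mathbf a_1,\mathbf a_2\in H$ lying on the two extremal rays of $C$. They are labeled $\mathbf a_1=(x_1,y_1)$, $\mathbf a_2=(x_2,y_2)$ so that $x_1>0$ and either $x_2=0$ or $y_1/x_1<y_2/x_2$. Put $\omega_H=\mathbb Z^2\cap\operatorname{relint}C$. The bottom element $\mathbf b$ of $H$ is the unique element of $\omega_H$ that is minimal (least) in $\omega_H$ for the componentwise order on $\mathbb N^2$ (it always exists). $H_1^*=\mathbb Z^2\cap\{r\mathbf a_1+s\mathbf b:0<r,s<1\}$, and $\pi_1(H_1^* )=\{k:\text{there exists }(k,\ell)\in H_1^*\}$ is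 the set of $x$-coordinates of points of $H_1^*$. $H$ is called AG1 if $\mathbf p+\mathbf q\notin H_1^*$ for all $\mathbf p,\mathbf q\in H_1^*$. *)

(* Defs.v *)
From HB Require Import structures.
From mathcomp Require Import all_boot all_order all_algebra.
From mathcomp Require Import all_classical all_reals all_analysis.
Import Order.TTheory GRing.Theory Num.Theory.
Import numFieldNormedType.Exports.

Set Implicit Arguments.
Unset Strict Implicit.
Unset Printing Implicit Defensive.

Local Open Scope classical_set_scope.
Local Open Scope ring_scope.

(* Semigroups H are subsets of Z^2, contained in the nonnegative quadrant;
   lat R embeds the lattice Z^2 into R^2. *)

Definition lat (R : realType) (p : int * int) : R * R :=
  (p.1%:~R, p.2%:~R).

Definition submonoid_gen (S : set (int * int)) : set (int * int) :=
  [set p | exists (n : nat) (c : 'I_n -> nat) (h : 'I_n -> int * int),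
     (forall i, S (h i)) /\ p = \sum_(i < n) h i *+ c i].

Definition subgroup_gen (S : set (int * int)) : set (int * int) :=
  [set p | exists (n : nat) (c : 'I_n -> int) (h : 'I_n -> int * int),
     (forall i, S (h i)) /\ p = \sum_(i < n) h i *~ c i].

Definition cone_gen (R : realType) (A : set (R * R)) : set (R * R) :=
  [set x | exists (n : nat) (c : 'I_n -> R) (a : 'I_n -> R * R),
     (forall i, 0 <= c i /\ A (a i)) /\ x = \sum_(i < n) c i *: a i].

Definition affine_hull (R : realType) (A : set (R * R)) : set (R * R) :=
  [set x | exists (n : nat) (c : 'I_n -> R) (a : 'I_n -> R * R),
     [/\ forall i, A (a i), \sum_(i < n) c i = 1 &
         x = \sum_(i < n) c i *: a i]].

(* interior of A relative to its affine hull *)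
Definition relint (R : realType) (A : set (R * R)) : set (R * R) :=
  [set x | A x /\ \forall y \near x, affine_hull A y -> A y].

Definition coneH (R : realType) (H : set (int * int)) : set (R * R) :=
  cone_gen (lat R @` H).
Arguments coneH : clear implicits.

Definition finitely_generated (H : set (int * int)) : Prop :=
  exists S : set (int * int), finite_set S /\ H = submonoid_gen S.

Definition normal_affine_N2 (R : realType) (H : set (int * int)) : Prop :=
  [/\ H `<=` [set p | 0 <= p.1 /\ 0 <= p.2],
      finitely_generated H,
      subgroup_gen H = setT &
      H = lat R @^-1` coneH R H].

Definition ray (R : realType) (x : R * R) : set (R * R) :=
  [set y | exists2 t : R, 0 <= t & y = t *: x].

(* one-dimensional faces of the convex cone C *)
Definition extremal_ray_of_cone (R : realType) (C rho : set (R * R)) : Prop :=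
  [/\ exists2 x, x != 0 & rho = ray x,
      rho `<=` C &
      forall y z, C y -> C z -> rho (y + z) -> rho y /\ rho z].

Definition primitive (p : int * int) : bool := coprimez p.1 p.2.

Definition extremal_ray (R : realType) (H : set (int * int))
    (a : int * int) : Prop :=
  [/\ H a, primitive a &
      exists2 rho, extremal_ray_of_cone (coneH R H) rho & rho (lat R a)].

(* a1 is the ray closer to the x-axis; the disjunct a2.1 = 0 is needed because
   division by 0 returns 0 *)
Definition extremal_rays (R : realType) (H : set (int * int))
    (a1 a2 : int * int) : Prop :=
  [/\ extremal_ray R H a1, extremal_ray R H a2, 0 < a1.1 &
      a2.1 = 0 \/ a1.2%:Q / a1.1%:Q < a2.2%:Q / a2.1%:Q].

Definition omega (R : realType) (H : set (int * int)) : set (int * int) :=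
  lat R @^-1` relint (coneH R H).

Definition bottom_element (R : realType) (H : set (int * int))
    (b : int * int) : Prop :=
  omega R H b /\ forall w, omega R H w -> b.1 <= w.1 /\ b.2 <= w.2.

Definition H1star (R : realType) (a1 b : int * int) : set (int * int) :=
  [set p | exists r s : R,
     [/\ 0 < r < 1, 0 < s < 1 & lat R p = r *: lat R a1 + s *: lat R b]].

Definition pi1 (A : set (int * int)) : set int := fst @` A.

(* The property of H, stated through a1 and b, which H determines. *)
Definition AG1 (R : realType) (a1 b : int * int) : Prop :=
  forall p q, H1star R a1 b p -> H1star R a1 b q -> ~ H1star R a1 b (p + q).

(* Main.v *)
(* Write [p = s a1 + t b] in the basis given by the extremal ray [a1] and the
   bottom element [b], and let [D = det (a1, b)].  Then [p] lies in [H_1^*] iff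
   [det (a1, p)] and [det (p, b)] lie strictly between [0] and [D].  Since
   [b - (0, 1)] is not interior to the cone, [D <= x1]; hence
   [det (a1, p) = x1 - r_k] for [p = (k, l)] in [H_1^*], and the inequality of
   the theorem says [det (a1, p + q) > D].  The condition [k + l < x1] replaces
   [det (p + q, b) < D], because [p + q - a1] would otherwise lie in the
   nonnegative quadrant; the boundary case [det (a1, p + q) = D] is excluded
   by the primitivity of [a1]. *)
Require Import Defs.
From HB Require Import structures.
From mathcomp Require Import all_boot all_order all_algebra.
From mathcomp Require Import all_classical all_reals all_analysis.
From mathcomp Require Import ring lra zify.
Import Order.TTheory GRing.Theory Num.Theory.
Import numFieldNormedType.Exports.

Local Open Scope classical_set_scope.
Local Open Scope ring_scope.

(** * Determinants and Cramer's rule in the plane *)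

Definition det2 {K : comNzRingType} (p q : K * K) : K := p.1 * q.2 - p.2 * q.1.

Lemma det2_lat (R : realType) (p q : int * int) :
  det2 (lat R p) (lat R q) = (det2 p q)%:~R.
Proof. by rewrite /det2 /= rmorphB !rmorphM. Qed.

Lemma cramer2 (R : realType) (a b x : R * R) : det2 a b != 0 ->
  x = (det2 x b / det2 a b) *: a + (det2 a x / det2 a b) *: b.
Proof.
case: a b x => [a a'] [b b'] [x x']; rewrite /det2 /= => D0.
have scaleE (c z : R) : c *: z = c * z by [].
by congr pair; rewrite /= !scaleE; field.
Qed.

(** * Generated cones and their relative interiors *)

Section ConeGen.
Variables (R : realType) (A : set (R * R)).
Local Notation C := (cone_gen A).

Lemma cone_gen0 : C 0.
Proof.
exists 0%N, (fun=> 0), (fun=> 0); split; first by case.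
by rewrite big_ord0.
Qed.

Lemma sub_cone_gen : A `<=` C.
Proof.
move=> x Ax; exists 1%N, (fun=> 1), (fun=> x); split=> //.
by rewrite big_ord1 scale1r.
Qed.

Lemma cone_genZ t x : 0 <= t -> C x -> C (t *: x).
Proof.
move=> t0 [n [c [a [ca ->]]]]; exists n, (fun i => t * c i), a; split.
  by move=> i; have [c0 Aa] := ca i; split=> //; exact: mulr_ge0.
by rewrite scaler_sumr; apply: eq_bigr => i _; rewrite scalerA.
Qed.

Lemma cone_genD x y : C x -> C y -> C (x + y).
Proof.
move=> [m [c [a [ca ->]]]] [n [d [b [db ->]]]].
exists (m + n)%N, (fun i : 'I_(m + n) => match fintype.split i with
    | inl j => c j | inr j => d j end),
  (fun i : 'I_(m + n) => match fintype.split i with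
    | inl j => a j | inr j => b j end); split.
  by move=> i; case: (fintype.split i).
rewrite big_split_ord; congr (_ + _); apply: eq_bigr => i _.
  by rewrite -[lshift n i]/(unsplit (inl i)) unsplitK.
by rewrite -[rshift m i]/(unsplit (inr i)) unsplitK.
Qed.

(* The affine hull of a cone is its linear span, since [0] is in the cone. *)
Lemma affine_hull_cone_gen t w y a : C a -> affine_hull C y ->
  affine_hull C (t *: y + w *: a).
Proof.
move=> Ca [n [c [e [Ce c1 ->]]]].
(* The coefficients [t * c i] and [w] add up to [t + w]; the missing [1 - t - w] is put on the apex
   [0]. *)
exists n.+2, (fun i => match fintype.split (i : 'I_(2 + n)) with
    | inl j => if j == ord0 then 1 - t - w else w | inr j => t * c j end),
  (fun i => match fintype.split (i : 'I_(2 + n)) with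
    | inl j => if j == ord0 then 0 else a | inr j => e j end); split.
- move=> i; case: fintype.split => j; last exact: Ce.
  by case: ifP => // _; exact: cone_gen0.
- rewrite (@big_split_ord _ _ _ 2 n) big_ord_recl big_ord1.
  rewrite -![lshift n _]/(unsplit (inl _)) !unsplitK /=.
  under eq_bigr => i _ do rewrite -[rshift 2 i]/(unsplit (inr i)) unsplitK.
  by rewrite -mulr_sumr c1; ring.
- rewrite (@big_split_ord _ _ _ 2 n) big_ord_recl big_ord1.
  rewrite -![lshift n _]/(unsplit (inl _)) !unsplitK /= scaler0 add0r.
  under [in RHS]eq_bigr => i _ do
    rewrite -[rshift 2 i]/(unsplit (inr i)) unsplitK -scalerA.
  by rewrite -scaler_sumr addrC.
Qed.

Lemma sub_affine_hull (B : set (R * R)) : B `<=` affine_hull B.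
Proof.
move=> x Bx; exists 1%N, (fun=> 1), (fun=> x); split=> //.
  by rewrite big_ord1.
by rewrite big_ord1 scale1r.
Qed.

(** The map [h] inverts [y |-> r a + s y], is continuous and preserves the linear span of the cone.
    Near [r a + s b] it takes values near [b], hence in the cone, and [y = r a + s h(y)] brings
    these back into the cone. *)
Lemma relint_cone_gen r s a b : 0 <= r -> 0 < s -> C a -> relint C b ->
  relint C (r *: a + s *: b).
Proof.
move=> r0 s0 Ca [Cb nearb]; split.
  by apply: cone_genD; apply: cone_genZ => //; exact: ltW.
pose h (y : R * R) := s^-1 *: (y - r *: a).
have hcvg : h y @[y --> r *: a + s *: b] --> b.
  have {2}-> : b = h (r *: a + s *: b).
    by rewrite /h addrAC subrr add0r scalerA mulVf ?scale1r// gt_eqF.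
  by apply: cvgZl_tmp; apply: cvgB; [exact: cvg_id|exact: cvg_cst].
apply: (@filterS _ _ (nbhs_filter _) _ _ _ (hcvg _ nearb)) => y /= nearh affy.
have -> : y = r *: a + s *: h y.
  by rewrite /h scalerA divff ?gt_eqF// scale1r addrC subrK.
apply: cone_genD; apply: cone_genZ => //; first exact: ltW.
apply: nearh; rewrite /h scalerBr scalerA -scaleNr.
exact: affine_hull_cone_gen.
Qed.

(** The point [b - e a] stays in the affine hull and tends to [b] as [e] tends to [0]. *)
Lemma relint_cone_gen_sub a b : C a -> relint C b ->
  exists2 e, 0 < e & C (b - e *: a).
Proof.
move=> Ca [Cb nearb].
have hcvg : b - e *: a @[e --> (0 : R)] --> b.
  rewrite -[X in _ --> X]subr0 -(scale0r a).
  by apply: cvgB; [exact: cvg_cst|apply: cvgZr_tmp; exact: cvg_id].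
have /nbhs_ballP[e /= e0 be] := hcvg _ nearb.
exists (e / 2); first by rewrite divr_gt0.
apply: be.
  by rewrite /ball /= sub0r normrN ger0_norm; [lra|rewrite divr_ge0// ltW].
rewrite -[X in affine_hull _ (X - _)]scale1r -scaleNr.
by apply: affine_hull_cone_gen => //; exact: sub_affine_hull.
Qed.

End ConeGen.

(** * Orientation of the extremal rays and coordinates of [H1star] *)

Lemma det2Zr (R : realType) (t : R) (p q : R * R) :
  det2 p (t *: q) = t * det2 p q.
Proof.
have scaleE (c z : R) : c *: z = c * z by [].
by rewrite /det2 /= !scaleE; ring.
Qed.

Lemma det2Dr (K : comNzRingType) (p q1 q2 : K * K) :
  det2 p (q1 + q2) = det2 p q1 + det2 p q2.
Proof. by rewrite /det2 /=; ring. Qed.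

Lemma det2C (K : comNzRingType) (p q : K * K) : det2 p q = - det2 q p.
Proof. by rewrite /det2; ring. Qed.

Lemma det2xx (K : comNzRingType) (p : K * K) : det2 p p = 0.
Proof. by rewrite /det2 mulrC subrr. Qed.

Lemma cone_gen_nneg (R : realType) (A : set (R * R)) :
  (forall x, A x -> 0 <= x.1 /\ 0 <= x.2) ->
  forall x, cone_gen A x -> 0 <= x.1 /\ 0 <= x.2.
Proof.
move=> A0 x [n [c [a [ca ->]]]].
apply: (big_ind (fun x : R * R => 0 <= x.1 /\ 0 <= x.2)) => //.
  by move=> y z [y1 y2] [z1 z2]; split; exact: addr_ge0.
by move=> i _; have [c0 /A0[a1 a2]] := ca i; split; exact: mulr_ge0.
Qed.

(* If [x] were on the wrong side of [a], then some positive multiple of [a]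
   would be the sum of [x] and a positive multiple of [c]. *)
Lemma extremal_ray_det2_ge0 {R : realType} {A : set (R * R)}
    {rho : set (R * R)} {a c x : R * R} :
  (forall x, A x -> 0 <= x.1 /\ 0 <= x.2) ->
  extremal_ray_of_cone (cone_gen A) rho -> rho a ->
  cone_gen A c -> 0 < det2 a c -> cone_gen A x -> 0 <= det2 a x.
Proof.
move=> /cone_gen_nneg C0 [[x0 _ ->] rhoC ext] rhoa Cc ac0 Cx.
rewrite leNgt; apply/negP => ax0.
have := cramer2 R a c x; rewrite gt_eqF// => /(_ isT).
set s := det2 x c / _; set t := det2 a x / _ => xE.
have t0 : t < 0 by rewrite ltr_pdivrMr// mul0r.
have [s0|s0] := leP 0 s.
  have Ctc : cone_gen A (- t *: c) by apply: cone_genZ => //; lra.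
  case: rhoa => t1 t10 aE.
  have [|_ [t2 _ cE]] := ext _ _ Cx Ctc.
    exists (s * t1); first exact: mulr_ge0.
    by rewrite xE scaleNr addrK aE scalerA.
  suff : det2 a (- t *: c) = 0.
    by rewrite det2Zr => /eqP; rewrite mulf_eq0 oppr_eq0 lt_eqF// gt_eqF.
  by rewrite cE aE det2Zr det2C det2Zr det2xx mulr0 oppr0 mulr0.
(* With [s] and [t] both negative, [x] lies in the nonnegative quadrant and in its opposite, so
   [x = 0]. *)
have [x10 x20] := C0 _ Cx; have [c10 c20] := C0 _ Cc.
have [a10 a20] := C0 _ (rhoC _ rhoa).
have scaleE (k z : R) : k *: z = k * z by [].
have x1E : x.1 = s * a.1 + t * c.1 by rewrite [in LHS]xE.
have x2E : x.2 = s * a.2 + t * c.2 by rewrite [in LHS]xE.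
have x1_0 : x.1 = 0 by nra.
have x2_0 : x.2 = 0 by nra.
by move: ax0; rewrite /det2 x1_0 x2_0 !mulr0 subrr ltxx.
Qed.

Lemma H1starP (R : realType) (a b p : int * int) : 0 < det2 a b ->
  H1star R a b p <-> 0 < det2 a p < det2 a b /\ 0 < det2 p b < det2 a b.
Proof.
move=> D0; have D0R : 0 < det2 (lat R a) (lat R b) by rewrite det2_lat ltr0z.
have lt (z : int) : 0 < z < det2 a b <->
    0 < z%:~R / det2 (lat R a) (lat R b) < (1 : R).
  by rewrite ltr_pdivlMr// mul0r ltr_pdivrMr// mul1r det2_lat ltr0z ltr_int.
rewrite !lt -!det2_lat; split=> [[r [s [r01 s01 ->]]]|[s01 r01]].
  rewrite det2Dr !det2Zr det2xx mulr0 add0r mulfK ?gt_eqF//.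
  rewrite det2C det2Dr !det2Zr det2xx mulr0 addr0 -mulrN -det2C.
  by rewrite mulfK ?gt_eqF.
exists (det2 (lat R p) (lat R b) / det2 (lat R a) (lat R b)).
exists (det2 (lat R a) (lat R p) / det2 (lat R a) (lat R b)).
by split=> //; apply: cramer2; rewrite gt_eqF.
Qed.

Lemma extremal_rays_det2_gt0 (R : realType) (H : set (int * int))
    (a1 a2 : int * int) : H `<=` [set p | 0 <= p.1 /\ 0 <= p.2] ->
  extremal_rays R H a1 a2 -> 0 < det2 a1 a2.
Proof.
case: a1 a2 => [x1 y1] [x2 y2] H0 [_ [/H0[/= x20 y20]]].
rewrite /primitive /det2 /= => prim _ x10 slope.
(* A primitive vector on the [y]-axis is [(0, 1)], so the determinant is [x1]. *)
have [x2_0|x2_neq0] := eqVneq x2 0; first by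
  move: prim; rewrite x2_0 /coprimez gcd0z; nia.
have {}x20 : 0 < x2 by lia.
case: slope => [/eqP|]; first by rewrite (negPf x2_neq0).
rewrite ltr_pdivrMr ?ltr0z// mulrAC ltr_pdivlMr ?ltr0z// -!rmorphM ltr_int.
by lia.
Qed.

(** * Consequences of the minimality of the bottom element *)

Section BottomElement.
Variables (R : realType) (H : set (int * int)) (a1 a2 b : int * int).
Hypothesis hH : normal_affine_N2 R H.
Hypothesis ha : extremal_rays R H a1 a2.
Hypothesis hb : bottom_element R H b.

Let H_nneg : H `<=` [set p | 0 <= p.1 /\ 0 <= p.2].
Proof. by case: hH. Qed.

Let lat_coneH p : H p -> coneH R H (lat R p).
Proof. by move=> Hp; apply: sub_cone_gen; exists p. Qed.

Let lat_nneg x : (lat R @` H) x -> 0 <= x.1 /\ 0 <= x.2.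
Proof. by move=> [p /H_nneg[p1 p2] <-]; rewrite /= !ler0z. Qed.

Let H_a1 : H a1. Proof. by case: ha => [[]]. Qed.
Let H_a2 : H a2. Proof. by case: ha => [_ []]. Qed.

Lemma omega_nneg p : omega R H p -> 0 <= p.1 /\ 0 <= p.2.
Proof.
by move=> [/(cone_gen_nneg _ _ lat_nneg)]; rewrite /= !ler0z.
Qed.

(** Some [b - e a2] with [e > 0] is still in the cone, so [det (a1, b)] is at least
    [e det (a1, a2) > 0]. *)
Lemma bottom_det2_gt0 : 0 < det2 a1 b.
Proof.
have := extremal_rays_det2_gt0 R H a1 a2 H_nneg ha.
rewrite -!(ltr0z R) -!det2_lat => D0.
have [[_ _ [rho ext rhoa]] _ _ _] := ha.
have ge0 := extremal_ray_det2_ge0 lat_nneg ext rhoa (lat_coneH _ H_a2) D0.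
have [e e0 /ge0] := relint_cone_gen_sub _ _ _ _ (lat_coneH _ H_a2) hb.1.
by rewrite -scaleNr det2Dr det2Zr; nra.
Qed.

(** This supplies the lattice points to which the minimality of [b] is applied: [p = r a1 + s b]
    with [r >= 0] and [s > 0]. *)
Lemma omega_cone_bottom p : 0 <= det2 p b -> 0 < det2 a1 p -> omega R H p.
Proof.
move=> pb ap; have D0 := bottom_det2_gt0.
have D0R : 0 < det2 (lat R a1) (lat R b) by rewrite det2_lat ltr0z.
rewrite /omega /preimage /=.
rewrite (cramer2 R (lat R a1) (lat R b) (lat R p)) ?gt_eqF//.
apply: relint_cone_gen; [| |exact: lat_coneH|exact: hb.1].
  by apply: divr_ge0; [rewrite det2_lat ler0z|exact: ltW].
by rewrite divr_gt0// det2_lat ltr0z.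
Qed.

Lemma bottom_det2_le : det2 a1 b <= a1.1.
Proof.
rewrite leNgt; apply/negP => ltD.
have [b10 _] := omega_nneg _ hb.1.
have [|_ /=] := hb.2 (b.1, b.2 - 1); last by lia.
by apply: omega_cone_bottom; move: ltD; rewrite /det2 /=; lia.
Qed.

Lemma H1star_bottom_lt p : H1star R a1 b p -> p.1 < a1.1.
Proof.
have D0 := bottom_det2_gt0.
move=> /(H1starP _ _ _ _ D0)[/andP[ap0 apD] /andP[pb0 pbD]].
(* The reflection [p |-> a1 + b - p] keeps [p] between [a1] and [b], and [b <= q] means [p <= a1]
   componentwise. If the first coordinates agreed, [det (a1, p)] could not be positive. *)
pose q := (a1.1 + b.1 - p.1, a1.2 + b.2 - p.2).
have [|q1 q2] := hb.2 q.
  by apply: omega_cone_bottom; move: apD pbD; rewrite /det2 /q /=; lia.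
have a10 : 0 < a1.1 by case: ha.
rewrite ltNge; apply/negP => p1.
have p1E : p.1 = a1.1 by move: q1 => /=; lia.
have p2 : p.2 <= a1.2 by move: q2 => /=; lia.
move: ap0; rewrite /det2 p1E.
by rewrite [a1.2 * _]mulrC -mulrBr pmulr_rgt0// subr_gt0 ltNge p2.
Qed.

Lemma H1star_bottom_modz p : H1star R a1 b p ->
  (p.1 * a1.2 %% a1.1)%Z = a1.1 - det2 a1 p.
Proof.
have D0 := bottom_det2_gt0; have Dle := bottom_det2_le.
move=> /(H1starP _ _ _ _ D0)[/andP[ap0 apD] _].
(* One multiple of [x1] is moved over so that the remainder lies in [[0, x1)], as
   [0 < det (a1, p) < D <= x1]. *)
have -> : p.1 * a1.2 = (p.2 - 1) * a1.1 + (a1.1 - det2 a1 p).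
  by rewrite /det2; ring.
by rewrite modzMDl modz_small//; lia.
Qed.

Lemma AG1_bottomE : AG1 R a1 b <->
  forall p q, H1star R a1 b p -> H1star R a1 b q -> p.1 + q.1 < a1.1 ->
    det2 a1 b < det2 a1 p + det2 a1 q.
Proof.
have D0 := bottom_det2_gt0.
have P := H1starP R a1 b _ D0.
split=> [ag p q hp hq pq_lt|hdet p q hp hq hpq]; last first.
  have := hdet _ _ hp hq (H1star_bottom_lt _ hpq).
  by have /P[/andP[_ + _]] := hpq; rewrite det2Dr => /lt_gtF ->.
rewrite ltNge; apply/negP => detle; apply: (ag _ _ hp hq).
move: hp hq => /P[/andP[ap0 apD] /andP[pb0 pbD]].
move=> /P[/andP[aq0 aqD] /andP[qb0 qbD]].
have pqb : det2 (p + q) b < det2 a1 b.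
  rewrite ltNge; apply/negP => le_pqb.
  have [] := omega_nneg (p + q - a1).
    apply: omega_cone_bottom; move: le_pqb ap0 aq0; rewrite /det2 /=; lia.
  by rewrite /=; lia.
apply/P; split; last first.
  by rewrite pqb andbT det2C det2Dr opprD -!det2C addr_gt0.
rewrite det2Dr addr_gt0//= lt_neqAle detle andbT.
apply/eqP => detE.
have a10 : 0 < a1.1 by case: ha.
have prim : coprimez a1.1 a1.2 by case: ha => [[]].
(* In the boundary case [w] is parallel to the primitive vector [a1], so [x1] divides [w.1]; this
   contradicts [0 < w.1 < x1]. *)
pose w := p + q - b.
have det0 : a1.1 * w.2 = w.1 * a1.2 by move: detE; rewrite /det2 /w /=; lia.
have : (a1.1 %| w.1)%Z.
  by rewrite -(Gauss_dvdzl _ prim) -det0 dvdz_mulr.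
have [b10 b20] := omega_nneg _ hb.1.
have w_lt : w.1 < a1.1 by rewrite /w /=; lia.
have w_gt : 0 < w.1.
  (* If [w = c a1], then [det (p + q, b) = det (w, b) = c D], while [w.1 = c x1]. *)
  have : w.1 * det2 a1 b = a1.1 * det2 (p + q) b.
    have -> : a1.1 * det2 (p + q) b = a1.1 * (w.1 * b.2) - a1.1 * w.2 * b.1.
      by rewrite /det2 /w /=; ring.
    by rewrite det0 /det2; ring.
  have : 0 < det2 (p + q) b by rewrite det2C det2Dr opprD -!det2C addr_gt0.
  by move=> pqb0 wE; rewrite -(pmulr_lgt0 _ D0) wE mulr_gt0.
move=> /dvdz_mod0P; rewrite modz_small ?w_lt ?ltW// => w0.
by rewrite w0 ltxx in w_gt.
Qed.

End BottomElement.

(** * Translation of the determinant criterion into residues modulo [x1] *)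

Theorem proposition5p20 (R : realType) (H : set (int * int))
    (x1 y1 x2 y2 u v : int) (r : int -> int)
    (hH : normal_affine_N2 R H)
    (ha : extremal_rays R H (x1, y1) (x2, y2))
    (hb : bottom_element R H (u, v))
    (hr : forall i : int, (r i = i * y1 %[mod x1])%Z /\ 0 <= r i < x1) :
  AG1 R (x1, y1) (u, v) <->
  (forall k l : int,
     pi1 (H1star R (x1, y1) (u, v)) k ->
     pi1 (H1star R (x1, y1) (u, v)) l ->
     k + l < x1 ->
     r k + r l < 2 * x1 - (v * x1 - u * y1)).
Proof.
have rE p : H1star R (x1, y1) (u, v) p -> r p.1 = x1 - det2 (x1, y1) p.
  move=> /(H1star_bottom_modz _ _ _ _ _ hH ha hb) /= <-.
  by have [<- r_lt] := hr p.1; rewrite modz_small.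
have DE : det2 (x1, y1) (u, v) = v * x1 - u * y1 by rewrite /det2 /=; ring.
apply: (iff_trans (AG1_bottomE _ _ _ _ _ hH ha hb)); rewrite DE.
split=> [hdet k l [p hp <-] [q hq <-] /(hdet _ _ hp hq)|hr2 p q hp hq pq].
  by rewrite !rE//; lia.
have := hr2 p.1 q.1 _ _ pq; rewrite !rE// => /(_ (ex_intro2 _ _ _ hp erefl)).
by move=> /(_ (ex_intro2 _ _ _ hq erefl)); lia.
Qed.
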